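(* Let $m,n\ge 1$ be integers and let $p_1,\dots,p_m\in[0,1]$. Let $\omega=\frac1m\sum_{j=1}^m \lambda_j$, where $\lambda_1,\dots,\lambda_m$ are independent Bernoulli random variables with $P(\lambda_j=1)=p_j$. Let $\omega_1,\dots,\omega_n$ be independent and identically distributed random variables, each with the distribution of $\omega$, and let $\bar\omega=\frac1n\sum_{i=1}^n\omega_i$. Put $\bar\sigma^2=\frac1m\sum_{j=1}^m p_j(1-p_j)$. Let $\epsilon>0$ and $\delta\in(0,1)$. If $$n\ \ge\ 2\log(2/\delta)\left(\frac{\bar\sigma^2}{m\epsilon^2}+\frac{1}{3\epsilon}\right),$$ then with probability at least $1-\delta$ one has $|\bar\omega-\mathbb{E}[\bar\omega]|\le\epsilon$.
   Context: $\log$ is the natural logarithm. Interpretation: in a nonlocal game with $m$ possible questions $q_1,\dots,q_m$, a round consists of the referee asking each question once. $\lambda_j\in\{0,1\}$ is the outcome (win $=1$, lose $=0$) on question $q_j$, $p_j$ is the win rate of question $q_j$, $\omega$ is the game value of one round, $n$ is the number of rounds, and $\bar\omega$ is the empirical estimate of the win rate after $n$ rounds. *)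

(* Defs.v *)
From HB Require Import structures.
From mathcomp Require Import all_boot all_order all_algebra.
From mathcomp Require Import all_classical all_reals all_analysis.
From mathcomp Require Import measurable_realfun.
Set Implicit Arguments.
Unset Strict Implicit.
Unset Printing Implicit Defensive.
Import Order.TTheory GRing.Theory Num.Theory.
Import numFieldNormedType.Exports.

Local Open Scope classical_set_scope.
Local Open Scope ring_scope.

Definition mutually_independent d d' (T : measurableType d)
    (T' : measurableType d') (R : realType) (P : probability T R)
    (I : finType) (X : I -> {RV P >-> T'}) : Prop :=
  forall (J : {set I}) (A : I -> set T'),
    (forall i, i \in J -> measurable (A i)) ->
    P (\bigcap_(i in [set` J]) (X i @^-1` A i)) =
    (\prod_(i in J) P (X i @^-1` A i))%E.

(* The equality is required on measurable sets only: a measure is a function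
   on all sets whose values on non-measurable sets are unconstrained. *)
Definition same_distribution d1 d2 d' (T1 : measurableType d1)
    (T2 : measurableType d2) (T' : measurableType d') (R : realType)
    (P1 : probability T1 R) (P2 : probability T2 R)
    (X1 : {RV P1 >-> T'}) (X2 : {RV P2 >-> T'}) : Prop :=
  forall A : set T', measurable A -> distribution P1 X1 A = distribution P2 X2 A.

Definition average (T : Type) (R : realType) (k : nat) (X : 'I_k -> T -> R) :
    T -> R :=
  fun t => k%:R^-1 * \sum_(i < k) X i t.

Definition round_value d (T : measurableType d) (R : realType)
    (P : probability T R) (m : nat) (lambda : 'I_m -> {RV P >-> bool}) : T -> R :=
  average (fun j t => (lambda j t)%:R).

Section round_value_measurable.
Context d (T : measurableType d) (R : realType) (P : probability T R) (m : nat).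
Variable lambda : 'I_m -> {RV P >-> bool}.

Lemma measurable_round_value :
  measurable_fun [set: T] (round_value lambda : T -> R).
Proof.
apply: measurable_funM; first exact: measurable_cst.
apply: measurable_sum => j.
exact: (@measurableT_comp _ _ _ _ _ _ (fun b : bool => b%:R : R)).
Qed.

HB.instance Definition _ :=
  isMeasurableFun.Build _ _ _ _ (round_value lambda) measurable_round_value.
End round_value_measurable.

(* Main.v *)
(* Bernstein's inequality for the [n m] Bernoulli variables underlying the rounds.
   Almost surely every [omega i] takes one of the values [k / m], so by
   independence every probability at stake is a finite sum of products of point
   masses, and the exponential moment of a round factors over the questions.
   For a Bernoulli variable of parameter [p] and [|s| = u < 3], the bound
   [exp y <= 1 + y + y^2 / (2 (1 - u / 3))] for [|y| <= u] yields
   [E exp (s (lambda - p)) <= exp (p (1 - p) u^2 / (2 (1 - u / 3)))].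
   The Chernoff bound with [u = eps / (sigma2 + eps / 3)] then gives the tail
   [2 exp (- n m eps^2 / (2 (sigma2 + eps / 3)))], which is at most [delta]
   (the hypothesis even leaves room, having [m eps / 3] where [eps / 3] is
   needed). *)
Require Import Defs.
From HB Require Import structures.
From mathcomp Require Import all_boot all_order all_algebra.
From mathcomp Require Import all_classical all_reals all_analysis.
From mathcomp Require Import measurable_realfun ring lra.
Import Order.TTheory GRing.Theory Num.Theory.
Import numFieldNormedType.Exports.
Local Open Scope classical_set_scope.
Local Open Scope ring_scope.

(** * Exponential bounds and the moment generating function of a centred Bernoulli variable *)

Lemma is_derive_MVT (R : realType) (f df : R -> R) (a b : R) :
  (forall x : R, is_derive x (1 : R) f (df x)) -> a <= b ->
  exists2 c, c \in `[a, b] & f b - f a = df c * (b - a).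
Proof.
move=> fdf ab; apply: MVT_segment => //.
by apply: derivable_within_continuous => x _; have [] := fdf x.
Qed.

(* [(6 + 4 y + y^2) / (6 - 2 y) = 1 + y + y^2 / (2 (1 - y / 3))] is the [2/1]
   Padé approximant of exp; the difference vanishes to order 4 at 0, so that it
   keeps its sign there. *)
Lemma expR_le_Pade (R : realType) (y : R) :
  expR y * (6 - 2 * y) <= 6 + 4 * y + y ^+ 2.
Proof.
pose F (y : R) := 6 + 4 * y + y ^+ 2 - expR y * (6 - 2 * y).
pose F' (y : R) := 4 + 2 * y - expR y * (4 - 2 * y).
pose F'' (y : R) := 2 - expR y * (2 - 2 * y).
have dF (x : R) : is_derive x (1 : R) F (F' x).
  by apply: is_derive_eq; rewrite /F' /GRing.scale /=; ring.
have dF' (x : R) : is_derive x (1 : R) F' (F'' x).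
  by apply: is_derive_eq; rewrite /F'' /GRing.scale /=; ring.
(* This is [1 - x <= expR (- x)] multiplied by [2 * expR x]. *)
have F''_ge0 x : 0 <= F'' x.
  have := expR_ge1Dx (- x); have := expRxMexpNx_1 x; have := expR_gt0 x.
  rewrite /F''; nra.
have F0 : F 0 = 0 by rewrite /F expR0; ring.
have F'0 : F' 0 = 0 by rewrite /F' expR0; ring.
suff : 0 <= F y by rewrite subr_ge0.
(* As [F''] is nonnegative and [F' 0 = 0], [F'] has the sign of its argument, so [F y = F' c * y] is
   nonnegative on both sides of 0. *)
case: (leP 0 y) => [y0|/ltW y0].
  have [c /[!in_itv]/= /andP[c0 _] /eqP] := is_derive_MVT _ _ _ _ _ dF y0.
  rewrite F0 !subr0 => /eqP ->; apply: mulr_ge0 => //.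
  have [e _ /eqP] := is_derive_MVT _ _ _ _ _ dF' c0.
  by rewrite F'0 !subr0 => /eqP ->; apply: mulr_ge0.
have [c /[!in_itv]/= /andP[_ c0] /eqP] := is_derive_MVT _ _ _ _ _ dF y0.
rewrite F0 !sub0r eqr_oppLR mulrN opprK => /eqP ->; apply: mulr_le0 => //.
have [e _ /eqP] := is_derive_MVT _ _ _ _ _ dF' c0.
by rewrite F'0 !sub0r eqr_oppLR mulrN opprK => /eqP ->; apply: mulr_ge0_le0.
Qed.

(** The Padé bound has [1 - y / 3] in the denominator; as [y <= u < 3], putting [u] for [y] there
    only enlarges the right-hand side. *)
Lemma expR_le_quadratic (R : realType) (u y : R) : 0 <= u < 3 -> `|y| <= u ->
  expR y <= 1 + y + y ^+ 2 / (2 * (1 - u / 3)).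
Proof.
move=> /andP[u0 u3]; rewrite ler_norml => /andP[uy yu].
have y3 : 0 < 6 - 2 * y by lra.
have c0 : 0 < 2 * (1 - u / 3) by lra.
have cy : 0 < 2 * (1 - y / 3) by lra.
have : expR y <= 1 + y + y ^+ 2 / (2 * (1 - y / 3)).
  rewrite (_ : 1 + _ + _ = (6 + 4 * y + y ^+ 2) / (6 - 2 * y)).
    by rewrite ler_pdivlMr// expR_le_Pade.
  by field; rewrite !lt0r_neq0//; lra.
move=> /le_trans; apply; rewrite lerD2l ler_wpM2l ?sqr_ge0// lef_pV2//.
by lra.
Qed.

(** In the mean of the quadratic bound the linear terms cancel and the second moment is the variance
    [p * (1 - p)]; then [1 + z <= expR z] applies. *)
Lemma bernoulli_mgf_le (R : realType) (p s u : R) : 0 <= p <= 1 ->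
  `|s| = u -> u < 3 ->
  p * expR (s * (1 - p)) + (1 - p) * expR (s * (0 - p)) <=
  expR (p * (1 - p) * (u ^+ 2 / (2 * (1 - u / 3)))).
Proof.
move=> /andP[p0 p1] su u3; set c := 2 * (1 - u / 3).
have u0 : 0 <= u < 3 by rewrite -su normr_ge0 su.
have s2 : s ^+ 2 = u ^+ 2 by rewrite -su real_normK// num_real.
have bnd q : `|q| <= 1 ->
    expR (s * q) <= 1 + s * q + (s * q) ^+ 2 / c.
  move=> q1; apply: expR_le_quadratic => //.
  by rewrite normrM su ler_piMr//; case/andP: u0.
apply: le_trans (expR_ge1Dx _).
have p1n : `|1 - p| <= 1 by rewrite ler_norml; lra.
have pn : `|0 - p| <= 1 by rewrite ler_norml; lra.
apply: le_trans (lerD (ler_wpM2l p0 (bnd _ p1n))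
  (ler_wpM2l _ (bnd _ pn))) _; first by lra.
by rewrite -s2 !exprMn le_eqVlt; apply/orP; left; apply/eqP; ring.
Qed.

(** * Finitely valued independent variables, averages and the Chernoff bound *)

(** The cells [C f] are disjoint and have product probabilities by independence. These add up to
    [\prod_i \sum_k q i k = 1], so the cells cover all but a null set, off which [E] is the union of
    the cells with [D f]. *)
Lemma probability_finite_valued (R : realType) (d d' : measure_display)
    (T : measurableType d) (T' : measurableType d') (P : probability T R)
    (I K : finType) (X : I -> {RV P >-> T'}) (x : K -> T') (q : I -> K -> R)
    (D : pred {ffun I -> K}) (E : set T) :
  injective x -> (forall k, measurable [set x k]) -> mutually_independent X ->
  (forall i k, P (X i @^-1` [set x k]) = (q i k)%:E) ->
  (forall i, \sum_k q i k = 1) -> measurable E ->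
  (forall t (f : {ffun I -> K}), (forall i, X i t = x (f i)) -> E t <-> D f) ->
  P E = (\sum_(f | D f) \prod_i q i (f i))%:E.
Proof.
move=> injx mx indX PX q1 mE ED.
pose C (f : {ffun I -> K}) :=
  \bigcap_(i in [set` [set: I]%SET]) (X i @^-1` [set x (f i)]).
have CP f t : C f t <-> forall i, X i t = x (f i).
  by split=> [Cf i|Xf i _ //]; apply: Cf; rewrite /= finset.in_setT.
have mC f : measurable (C f).
  apply: fin_bigcap_measurable; first exact: finite_finset.
  by move=> i _; exact: measurable_funPTI.
have PC f : P (C f) = (\prod_i q i (f i))%:E.
  rewrite (indX _ (fun i => [set x (f i)]))// -prodEFin.
  by apply: eq_big => [i|i _]; [rewrite finset.in_setT|rewrite PX].
have tC (A : set {ffun I -> K}) : trivIset A C.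
  move=> f g _ _ [t [/CP ft /CP gt]]; apply/ffunP => i; apply: injx.
  by rewrite -ft gt.
pose U (A : pred {ffun I -> K}) := \bigcup_(f in [set` A]) C f.
have mU A : measurable (U A).
  by apply: fin_bigcup_measurable => //; exact: finite_finset.
have PU A : P (U A) = (\sum_(f | A f) \prod_i q i (f i))%:E.
  rewrite /U measure_fin_bigcup; [|exact: finite_finset|exact: tC|by []].
  rewrite -(bigfs _ (index_enum_uniq _)); last by move=> f _; rewrite mem_index_enum.
  by rewrite -sumEFin; apply: eq_bigr => f _; rewrite -PC.
have PUT : P (~` U predT) = 0%E.
  rewrite probability_setC// PU -bigA_distr_bigA big1 ?subee//.
have -> : E = (E `&` U predT) `|` (E `&` ~` U predT).
  by rewrite -setIUr setUv setIT.
rewrite measureU0; last 3 first.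
- exact: measurableI.
- by apply: measurableI => //; exact: measurableC.
- apply/eqP; rewrite -measure_le0 -PUT le_measure ?inE//.
  + by apply: measurableI => //; exact: measurableC.
  + exact: measurableC.
rewrite -PU; congr (P _); apply/seteqP; split=> [t [Et [f _ Cft]]|t [f Df Cft]].
  by exists f => //=; apply/(ED t) => //; exact/CP.
by split; [apply/(ED _ f) => //; exact/CP|exists f].
Qed.

Lemma expectation_average (R : realType) (d : measure_display)
    (T : measurableType d) (P : probability T R) (k : nat) (X : 'I_k -> T -> R)
    (mu : 'I_k -> R) :
  (forall i, X i \in Lfun P 1) -> (forall i, ('E_P[X i] = (mu i)%:E)%E) ->
  ('E_P[average X] = (k%:R^-1 * \sum_(i < k) mu i)%:E)%E.
Proof.
move=> iX EX.
have -> : average X = k%:R^-1 \o* (\sum_(Y <- [seq X i | i <- index_enum 'I_k]) Y).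
  by apply/funext => t; rewrite /average /= big_map fct_sumE mulrC.
have iXs Y : Y \in [seq X i | i <- index_enum 'I_k] -> Y \in Lfun P 1.
  by case/mapP => i _ ->.
rewrite expectationZl; last by rewrite big_seq rpred_sum.
rewrite expectation_sum// big_map (eq_bigr (EFin \o mu))// sumEFin.
by rewrite -EFinM.
Qed.

(** The powers expand into sums over [f] of products. On a summand of the left-hand side, one of the
    two signs gives an exponential of at least [expR (n%:R * (s * eps))], and the other is dropped
    as nonnegative. *)
Lemma chernoff_finite (R : realType) (K : finType) (n : nat) (q x : K -> R)
    (mu s eps : R) : (forall k, 0 <= q k) -> 0 <= s ->
  \sum_(f : {ffun 'I_n -> K} | n%:R * eps < `|\sum_i (x (f i) - mu)|)
    \prod_i q (f i) <=
  expR (- (n%:R * (s * eps))) *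
  ((\sum_k q k * expR (s * (x k - mu))) ^+ n +
   (\sum_k q k * expR (- s * (x k - mu))) ^+ n).
Proof.
move=> q0 s0.
have mgf_sum r : (\sum_k q k * expR (r * (x k - mu))) ^+ n =
    \sum_(f : {ffun 'I_n -> K})
      (\prod_i q (f i)) * expR (r * \sum_i (x (f i) - mu)).
  rewrite -[LHS]mulr1 -[n in LHS]card_ord -prodr_const mulr1.
  rewrite bigA_distr_bigA; apply: eq_bigr => f _.
  by rewrite big_split/= mulr_sumr expR_sum.
rewrite !mgf_sum -big_split/= mulr_sumr big_mkcond/=.
apply: ler_sum => f _; have qf : 0 <= \prod_i q (f i) by exact: prodr_ge0.
set S := \sum_i _; rewrite -mulrDr mulrCA mulrDr -!expRD.
case: ifPn => [|_]; last by rewrite mulr_ge0// addr_ge0// expR_ge0.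
rewrite lter_normr => /orP[] epsS; rewrite ler_peMr//.
  rewrite -[leLHS]addr0 lerD ?expR_ge0// -[leLHS]expR0 ler_expR.
  by have := ler_wpM2l s0 (ltW epsS); lra.
rewrite -[leLHS]add0r lerD ?expR_ge0// -[leLHS]expR0 ler_expR.
by have := ler_wpM2l s0 (ltW epsS); lra.
Qed.

(** * The law of the number of wins in one round *)

(** The Poisson binomial distribution. *)
Definition round_pmf {R : realType} {m : nat} (p : 'I_m -> R) (k : 'I_m.+1) : R :=
  \sum_(g : {ffun 'I_m -> bool} | (\sum_j g j)%N == k)
    \prod_j bernoulli_pmf (p j) (g j).

(** Grouping the outcome vectors by their number of wins; used to return from counts to independent
    outcomes, where exponentials factor. *)
Lemma sum_round_pmf (R : realType) (m : nat) (p : 'I_m -> R) (F : nat -> R) :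
  \sum_k round_pmf p k * F k =
  \sum_(g : {ffun 'I_m -> bool})
    (\prod_j bernoulli_pmf (p j) (g j)) * F (\sum_j g j)%N.
Proof.
(* Ensures that [inord] below never falls back on its default value. *)
have lem (g : {ffun 'I_m -> bool}) : (\sum_j g j < m.+1)%N.
  rewrite ltnS -[leqRHS](card_ord m) -sum1_card.
  by apply: leq_sum => j _; case: (g j).
rewrite [RHS](partition_big (fun g : {ffun 'I_m -> bool} =>
  inord (\sum_j g j)%N : 'I_m.+1) xpredT)//=.
apply: eq_bigr => k _; rewrite mulr_suml; apply: eq_big => [g|g /eqP -> //].
by rewrite -val_eqE /= inordK.
Qed.

Lemma round_pmf_ge0 (R : realType) (m : nat) (p : 'I_m -> R) k :
  (forall j, 0 <= p j <= 1) -> 0 <= round_pmf p k.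
Proof.
by move=> hp; apply: sumr_ge0 => g _; apply: prodr_ge0 => j _;
  exact: bernoulli_pmf_ge0.
Qed.

Lemma sum_bernoulli_pmf (R : realType) (p : R) (F : bool -> R) :
  \sum_b bernoulli_pmf p b * F b = p * F true + (1 - p) * F false.
Proof. by rewrite big_bool. Qed.

Lemma round_pmf1 (R : realType) (m : nat) (p : 'I_m -> R) :
  \sum_k round_pmf p k = 1.
Proof.
under eq_bigr do rewrite -[round_pmf _ _]mulr1.
rewrite (sum_round_pmf _ _ _ (fun=> 1)).
under eq_bigr do rewrite mulr1.
rewrite -(bigA_distr_bigA (fun j b => bernoulli_pmf (p j) b)) big1// => j _.
by rewrite big_bool /= subrKC.
Qed.

(** The factor [m%:R] cancels the averaging, so the exponent is the sum of the
    [s * ((g j)%:R - p j)] and the moment is a product of Bernoulli ones. *)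
Lemma round_mgf_le (R : realType) (m : nat) (p : 'I_m -> R) (s u : R) :
  (0 < m)%N -> (forall j, 0 <= p j <= 1) -> `|s| = u -> u < 3 ->
  \sum_k round_pmf p k *
    expR (s * m%:R * (m%:R^-1 * k%:R - m%:R^-1 * \sum_j p j)) <=
  expR ((\sum_j p j * (1 - p j)) * (u ^+ 2 / (2 * (1 - u / 3)))).
Proof.
move=> m0 hp su u3.
rewrite (sum_round_pmf _ _ _ (fun k => expR (s * m%:R * (m%:R^-1 * k%:R - _)))).
have mn0 : m%:R != 0 :> R by rewrite pnatr_eq0 -lt0n.
rewrite (eq_bigr (fun g : {ffun 'I_m -> bool} =>
    \prod_j (bernoulli_pmf (p j) (g j) * expR (s * ((g j)%:R - p j))))); last first.
  move=> g _; rewrite big_split/= -expR_sum; congr (_ * expR _).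
  rewrite -mulr_sumr -mulrBr mulrA mulfK// natr_sum sumrB//.
rewrite -(bigA_distr_bigA
  (fun j (b : bool) => bernoulli_pmf (p j) b * expR (s * (b%:R - p j)))).
rewrite mulr_suml expR_sum; apply: ler_prod => j _.
rewrite sum_bernoulli_pmf bernoulli_mgf_le// andbT.
have /andP[p0 p1] := hp j.
by rewrite addr_ge0// mulr_ge0 ?expR_ge0// subr_ge0.
Qed.

(** * Transfer of expectations between equal laws *)

(** Integrability and expectation are both integrals against the law, and such integrals depend only
    on its values on measurable sets. *)
Lemma same_distribution_expectation (R : realType) (d1 d2 : measure_display)
    (T1 : measurableType d1) (T2 : measurableType d2)
    (P1 : probability T1 R) (P2 : probability T2 R)
    (X1 : {RV P1 >-> R}) (X2 : {RV P2 >-> R}) :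
  same_distribution X1 X2 -> (X2 : T2 -> R) \in Lfun P2 1 ->
  (X1 : T1 -> R) \in Lfun P1 1 /\ ('E_P1[X1] = 'E_P2[X2])%E.
Proof.
move=> X12 /Lfun1_integrable iX2.
have eqint (f : R -> \bar R) :
    (\int[distribution P1 X1]_y f y = \int[distribution P2 X2]_y f y)%E.
  by apply: eq_measure_integral => A mA _; exact: X12.
have mabs : measurable_fun [set: R] (fun y : R => `|y%:E|%E).
  exact: measurableT_comp.
have iX1 : P1.-integrable [set: T1] (EFin \o X1).
  apply/integrableP; split; first exact: measurableT_comp.
  have := @ge0_integral_distribution _ _ _ _ _ P1 X1 _ mabs (fun=> abse_ge0 _).
  have := @ge0_integral_distribution _ _ _ _ _ P2 X2 _ mabs (fun=> abse_ge0 _).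
  rewrite eqint => -> /= <-.
  by case/integrableP : iX2.
split; first exact/Lfun1_integrable.
rewrite !expectation_def -(integral_distribution (P := P1) (f := EFin))//.
by rewrite eqint integral_distribution.
Qed.

Lemma Lfun_average (R : realType) (d : measure_display)
    (T : measurableType d) (P : probability T R) (k : nat) (X : 'I_k -> T -> R) :
  (forall i, X i \in Lfun P 1) -> average X \in Lfun P 1.
Proof.
move=> iX.
have -> : average X = k%:R^-1 *: (\sum_(i < k) X i) :> (T -> R).
  by apply/funext => t; rewrite /average /= fct_sumE.
by apply: rpredZ; apply: rpred_sum.
Qed.

(** * Mean and point masses of a round value *)

Section bernoulli_round.
Context (R : realType) (m : nat) (p : 'I_m -> R).
Context (d : measure_display) (T : measurableType d) (P : probability T R).
Context (lambda : 'I_m -> {RV P >-> bool}).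
Context (hp : forall j, 0 <= p j <= 1).
Context (hlambda : forall j,
  distribution P (lambda j) = bernoulli_prob (p j) :> (set bool -> \bar R)).

Lemma bernoulli_point j b :
  P (lambda j @^-1` [set b]) = (bernoulli_pmf (p j) b)%:E.
Proof.
rewrite -[LHS]/(distribution P (lambda j) [set b]) hlambda.
(* [bernoulli_prob] is defined by cases on its parameter lying in [[0, 1]]; [hp] selects the genuine
   case. *)
by rewrite /bernoulli_prob hp fsbig_set1.
Qed.

Lemma expectation_bernoulli j :
  (fun t => (lambda j t)%:R : R) \in Lfun P 1 /\
  ('E_P[fun t => (lambda j t)%:R : R] = (p j)%:E)%E.
Proof.
have mj : measurable (lambda j @^-1` [set true]) by exact: measurable_funPTI.
have -> : (fun t => (lambda j t)%:R : R) = \1_(lambda j @^-1` [set true]).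
  apply/funext => t; rewrite indicE; congr (nat_of_bool _)%:R.
  by apply/idP/idP => [h|/set_mem /= -> //]; apply/mem_set.
split; first exact/Lfun1_integrable/integrable_indic.
by rewrite expectation_indic// bernoulli_point.
Qed.

Lemma expectation_round_value :
  round_value lambda \in Lfun P 1 /\
  ('E_P[round_value lambda] = (m%:R^-1 * \sum_j p j)%:E)%E.
Proof.
have E := expectation_bernoulli; split.
  by apply: Lfun_average => j; have [] := E j.
by apply: expectation_average => j; have [] := E j.
Qed.

(** The reduction to finite sums is used here over the questions of one round; the theorem uses it
    again over the rounds. *)
Lemma round_value_pmf (k : 'I_m.+1) : (0 < m)%N -> mutually_independent lambda ->
  P (round_value lambda @^-1` [set m%:R^-1 * k%:R]) = (round_pmf p k)%:E.
Proof.
move=> m0 indep.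
have mk : m%:R^-1 != 0 :> R by rewrite invr_neq0// pnatr_eq0 -lt0n.
apply: (@probability_finite_valued _ _ _ _ _ P _ bool lambda id
    (fun j => bernoulli_pmf (p j)) (fun g => (\sum_j g j)%N == k)) => //.
- by move=> j b; exact: bernoulli_point.
- by move=> j; rewrite big_bool /= subrKC.
move=> t g tg.
have -> : (round_value lambda @^-1` [set m%:R^-1 * k%:R]) t =
    (m%:R^-1 * (\sum_j g j)%N%:R = m%:R^-1 * k%:R :> R).
  rewrite /= /round_value /average natr_sum; congr (_ * _ = _).
  by apply: eq_bigr => j _; rewrite tg.
by split=> [/(mulfI mk)/eqP|/eqP ->//]; rewrite eqr_nat.
Qed.

End bernoulli_round.

(* The optimal parameter [eps / (v + eps / 3)] of Bernstein's inequality reaches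
   the excluded value 3 when [v = 0]; any fixed value in [3/2, 3) works then. *)
Lemma bernstein_parameter (R : realType) (m n v eps L : R) :
  1 <= m -> 0 <= v -> 0 < eps -> 0 < L ->
  2 * L * (v / (m * eps ^+ 2) + 1 / (3 * eps)) <= n ->
  exists2 u, 0 < u < 3 &
    L <= n * (m * (u * eps - v * (u ^+ 2 / (2 * (1 - u / 3))))).
Proof.
move=> m1; rewrite le_eqVlt => /orP[/eqP <-|v0] e0 L0 hn.
  (* With [v = 0] the hypothesis reads [2 * L <= n * (3 * eps)]; half of it is the goal up to the
     factor [m >= 1]. *)
  exists (3 / 2); first by lra.
  rewrite !mul0r add0r in hn; rewrite mul0r subr0.
  have : 2 * L <= n * (3 * eps) by rewrite -ler_pdivrMr ?mulr_gt0// -div1r.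
  move=> Ln; have w0 : 0 <= n * (3 * eps) by lra.
  by have := ler_wpM2r w0 m1; lra.
have ve : 0 < v + eps / 3 by rewrite addr_gt0// divr_gt0.
exists (eps / (v + eps / 3)).
  by rewrite divr_gt0//= ltr_pdivrMr//; lra.
(* For this [u], [1 - u / 3 = v / (v + eps / 3)], so the subtracted term is half of [u * eps]. *)
rewrite (_ : _ - _ = eps ^+ 2 / (2 * (v + eps / 3))); last first.
  by field; lra.
have m0 : 0 < m by lra.
have nE : 2 * L * (v + m * eps / 3) <= n * (m * eps ^+ 2).
  rewrite -ler_pdivrMr; last by rewrite mulr_gt0// exprn_gt0.
  apply: le_trans hn; rewrite le_eqVlt; apply/orP; left; apply/eqP; field.
  by rewrite !lt0r_neq0.
rewrite !mulrA ler_pdivlMr ?mulr_gt0//.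
apply: le_trans (_ : 2 * L * (v + m * eps / 3) <= _); last by lra.
rewrite [leLHS](_ : _ = 2 * L * (v + eps / 3)); last by ring.
apply: ler_wpM2l; first by lra.
by have := ler_wpM2r (ltW e0) m1; lra.
Qed.

Theorem corollary6p2 (R : realType) (m n : nat) (hm : (1 <= m)%N) (hn : (1 <= n)%N)
  (p : 'I_m -> R) (hp : forall j, 0 <= p j <= 1)
  (d0 : measure_display) (T0 : measurableType d0) (P0 : probability T0 R)
  (lambda : 'I_m -> {RV P0 >-> bool})
  (hlambda : forall j,
     distribution P0 (lambda j) =
     bernoulli_prob (p j) :> (set bool -> \bar R))
  (hlambda_indep : mutually_independent lambda)
  (d : measure_display) (T : measurableType d) (P : probability T R)
  (omega : 'I_n -> {RV P >-> R})
  (homega_indep : mutually_independent omega)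
  (homega : forall i, same_distribution (omega i) (round_value lambda : {RV P0 >-> R}))
  (eps delta : R) (heps : 0 < eps) (hdelta : 0 < delta < 1)
  (sigma2 : R) (hsigma2 : sigma2 = m%:R^-1 * \sum_(j < m) p j * (1 - p j))
  (hlarge : n%:R >= 2 * ln (2 / delta) *
                    (sigma2 / (m%:R * eps ^+ 2) + 1 / (3 * eps))) :
  ((1 - delta)%:E <=
   P [set t | `|(average omega t)%:E - 'E_P[average omega]| <= eps%:E])%E.
Proof.
pose mu := m%:R^-1 * \sum_j p j.
pose x (k : 'I_m.+1) : R := m%:R^-1 * k%:R.
have mR0 : m%:R != 0 :> R by rewrite pnatr_eq0 -lt0n.
have nR0 : 0 < n%:R :> R by rewrite ltr0n.
have [iomega Eomega] : (forall i, (omega i : T -> R) \in Lfun P 1) /\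
    (forall i, 'E_P[omega i] = mu%:E)%E.
  have [iround Eround] := expectation_round_value _ _ _ _ _ P0 _ hp hlambda.
  split=> i; have [+ +] := same_distribution_expectation _ _ _ _ _ _ _ _ _
    (homega i) iround; first by [].
  by move=> _ ->.
have -> : ('E_P[average omega] = mu%:E)%E.
  rewrite (expectation_average _ _ _ _ _ _ (fun=> mu))//.
  by rewrite sumr_const card_ord -[mu *+ n]mulr_natl mulKf// gt_eqF.
set good := [set t | _].
have mavg : measurable_fun [set: T] (average omega).
  by apply: measurable_funM => //; apply: measurable_sum.
have mgood : measurable good.
  have -> : good = [set t | `|average omega t - mu| <= eps].
    by apply/seteqP; split=> t; rewrite /good /= lee_fin.
  rewrite (_ : [set t | _] = setT `&`
    (fun t => `|average omega t - mu|) @^-1` `]-oo, eps]).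
    apply: measurableT_comp => //; first exact: measurable_funB.
  by rewrite setTI; apply/seteqP; split=> t /=; rewrite in_itv.
have [u /andP[u0 u3] hu] : exists2 u, 0 < u < 3 & ln (2 / delta) <=
    n%:R * (m%:R * (u * eps - sigma2 * (u ^+ 2 / (2 * (1 - u / 3))))).
  apply: bernstein_parameter => //; rewrite ?ler1n//.
    rewrite hsigma2 mulr_ge0// sumr_ge0// => j _.
    by have /andP[p0 p1] := hp j; rewrite mulr_ge0// subr_ge0.
  by apply: ln_gt0; rewrite ltr_pdivlMr; lra.
have Pbad : (P (~` good) <= delta%:E)%E.
  (* Here [f i] is the number of wins in round [i], and the deviation is multiplied by [n] to become
     a sum over rounds. *)
  rewrite (@probability_finite_valued _ _ _ _ _ P _ _ omega x
    (fun=> round_pmf p)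
    (fun f => n%:R * eps < `|\sum_i (x (f i) - mu)|)) ?lee_fin//; last first.
  - move=> t f tf; rewrite /good /= lee_fin.
    rewrite (_ : average omega t - mu = n%:R^-1 * \sum_i (x (f i) - mu)).
      rewrite normrM gtr0_norm ?invr_gt0// mulrC ler_pdivrMr// mulrC.
      by rewrite ltNge; split=> [/negP|/negP].
    rewrite sumrB mulrBr sumr_const card_ord -[mu *+ n]mulr_natl mulKf ?gt_eqF//.
    by rewrite /average; under eq_bigr do rewrite tf.
  - exact: measurableC.
  - by move=> _; exact: round_pmf1.
  - move=> i k; rewrite -[LHS]/(distribution P (omega i) [set x k]) homega//.
    exact: (round_value_pmf _ _ _ _ _ _ _ hp hlambda).
  - have mV0 : m%:R^-1 != 0 :> R by rewrite invr_neq0.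
    by move=> k l /(mulfI mV0)/eqP; rewrite eqr_nat => /eqP/val_inj.
  (* The parameter [u * m%:R] undoes the averaging within a round, so that each question sees the
     parameter [u]. *)
  apply: le_trans (chernoff_finite _ _ _ _ _ _ (u * m%:R) _ _ _) _.
  - by move=> k; exact: round_pmf_ge0.
  - by rewrite mulr_ge0// ltW.
  (* Stated through the absolute value of [s] to serve both tails, [s = u] and [s = - u]. *)
  have mgf s : `|s| = u -> (\sum_k round_pmf p k *
      expR (s * m%:R * (x k - mu))) ^+ n <=
      expR (n%:R * (m%:R * (sigma2 * (u ^+ 2 / (2 * (1 - u / 3)))))).
    move=> su; rewrite [leRHS]expRM_natl; apply: lerXn2r.
    - by rewrite nnegrE sumr_ge0// => k _; rewrite mulr_ge0 ?expR_ge0// round_pmf_ge0.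
    - by rewrite nnegrE expR_ge0.
    - rewrite [in leRHS]mulrA hsigma2 mulVKf//.
      exact: round_mgf_le.
  have uabs : `|u| = u by rewrite gtr0_norm.
  have := lerD (mgf u uabs) (mgf (- u) (etrans (normrN u) uabs)).
  rewrite [- u * _]mulNr => /(ler_wpM2l (expR_ge0 (- (n%:R * (u * m%:R * eps)))))/le_trans; apply.
  rewrite mulrDr -!expRD -mulr2n -[leLHS]mulr_natl.
  have delta0 : 0 < delta by lra.
  (* By [hu] each tail is at most [expR (- ln (2 / delta))], that is [delta / 2]. *)
  rewrite [leRHS](_ : _ = 2 * expR (- ln (2 / delta))).
    by rewrite ler_pM2l// ler_expR; lra.
  by rewrite expRN lnK ?posrE ?divr_gt0// invf_div mulrC divfK.
rewrite -[good]setCK probability_setC; last exact: measurableC.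
by rewrite EFinB leeB.
Qed.
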